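(* $\mathrm{Brun}(T_4)$ is a free group of infinite rank.
   Context: For $n\ge 2$ the twin group $T_n$ is generated by $t_1,\dots,t_{n-1}$ with relations $t_i^2=1$ and $t_it_j=t_jt_i$ for $|i-j|\ge 2$; $T_1$ is trivial. Geometrically its elements (twins) are homotopy classes of configurations of $n$ monotone strands in $\mathbb R\times[0,1]$ joining $n$ marked points on $y=1$ to $n$ marked points on $y=0$, with no three strands through a common point; the product is stacking (left factor on top), and $t_i$ is the single crossing of the strands in positions $i,i+1$. For $u\in T_n$ let $\nu(u)\in S_n$ be the permutation such that the strand of $u$ starting at position $k$ ends at position $\nu(u)(k)$. The pure twin group $PT_n$ is the subgroup of all $u$ with $\nu(u)=1$. For $0\le i\le n-1$ the map $d_i:T_n\to T_{n-1}$ deletes the strand starting at position $i+1$; it is determined by $d_i(uw)=d_i(u)\,d_{\nu(u)(i+1)-1}(w)$ together with $d_i(t_j)=t_{j-1}$ if $i+1<j$, $d_i(t_j)=1$ if $i+1\in\{j,j+1\}$, and $d_i(t_j)=t_j$ if $i+1>j+1$. It restricts to a group homomorphism $PT_n\to PT_{n-1}$. A pure twin is Brunnian if it becomes trivial after removing any one of its strands, i.e. $\mathrm{Brun}(T_n)=\bigcap_{i=0}^{n-1}\ker(d_i:PT_n\to PT_{n-1})$. *)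

(* Defs.v *)
From HB Require Import structures.
From mathcomp Require Import all_boot all_fingroup.
From mathcomp Require Import zify.
From mathcomp Require Import boolp classical_sets cardinality.

Set Implicit Arguments.
Unset Strict Implicit.
Unset Printing Implicit Defensive.

Local Open Scope quotient_scope.
Local Open Scope group_scope.

(* The letter (x, true) stands for the generator x and (x, false) for x^-1. *)
Definition word (X : Type) := seq (X * bool).

Definition inv_word (X : Type) (w : word X) : word X :=
  rev [seq (l.1, ~~ l.2) | l <- w].

(* rels u v means that the relation u = v is imposed. *)
Inductive word_eqv (X : Type) (rels : word X -> word X -> Prop) :
    word X -> word X -> Prop :=
| word_eqv_refl u : word_eqv rels u u
| word_eqv_sym u v : word_eqv rels u v -> word_eqv rels v u
| word_eqv_trans u v w :
    word_eqv rels u v -> word_eqv rels v w -> word_eqv rels u w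
| word_eqv_cancel p x b q :
    word_eqv rels (p ++ [:: (x, b); (x, ~~ b)] ++ q) (p ++ q)
| word_eqv_rel p u v q :
    rels u v -> word_eqv rels (p ++ u ++ q) (p ++ v ++ q).

Section Congruence.
Variables (X : Type) (rels : word X -> word X -> Prop).
Local Notation "u ~ v" := (word_eqv rels u v) (at level 70).

Lemma word_eqv_ctx p q u v : u ~ v -> p ++ u ++ q ~ p ++ v ++ q.
Proof.
elim=> {u v} [u|u v _|u v w _ IH1 _|r x b s|r u v s uv].
- exact: word_eqv_refl.
- exact: word_eqv_sym.
- exact: (word_eqv_trans IH1).
- have := word_eqv_cancel rels (p ++ r) x b (s ++ q).
  by rewrite -!catA.
- have := word_eqv_rel (p ++ r) (s ++ q) uv.
  by rewrite -!catA.
Qed.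

Lemma word_eqv_cat u u' v v' : u ~ u' -> v ~ v' -> u ++ v ~ u' ++ v'.
Proof.
move=> uu' vv'; apply: (word_eqv_trans (v := u' ++ v)).
  exact: (word_eqv_ctx [::] v uu').
by have := word_eqv_ctx u' [::] vv'; rewrite !cats0.
Qed.

Lemma inv_word_cat (u v : word X) : inv_word (u ++ v) = inv_word v ++ inv_word u.
Proof. by rewrite /inv_word map_cat rev_cat. Qed.

Lemma inv_wordK : involutive (@inv_word X).
Proof.
move=> u; rewrite /inv_word map_rev revK -map_comp -[RHS]map_id.
by apply: eq_map => -[x b] /=; rewrite negbK.
Qed.

Lemma word_eqvV u : inv_word u ++ u ~ [::].
Proof.
elim: u => [|[x b] u IH]; first exact: word_eqv_refl.
rewrite -[_ :: u]/([:: (x, b)] ++ u) inv_word_cat -catA.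
apply: word_eqv_trans IH.
have := word_eqv_cancel rels (inv_word u) x (~~ b) u.
by rewrite negbK.
Qed.

Lemma word_eqvVr u : u ++ inv_word u ~ [::].
Proof. by rewrite -{1}[u]inv_wordK; exact: word_eqvV. Qed.

Lemma word_eqv_inv u v : u ~ v -> inv_word u ~ inv_word v.
Proof.
move=> uv; apply: (word_eqv_trans (v := inv_word u ++ v ++ inv_word v)).
  have := word_eqv_cat (word_eqv_refl _ (inv_word u)) (word_eqvVr v).
  by rewrite cats0; exact: word_eqv_sym.
rewrite catA -[X in _ ~ X]cat0s.
apply: word_eqv_cat (word_eqv_refl _ _).
apply: word_eqv_trans (word_eqvV u).
exact: word_eqv_cat (word_eqv_refl _ _) (word_eqv_sym uv).
Qed.

End Congruence.

Section Presented.
Variables (X : choiceType) (rels : word X -> word X -> Prop).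

Definition word_eqvb (u v : word X) : bool := `[< word_eqv rels u v >].

Lemma word_eqvb_refl : reflexive word_eqvb.
Proof. by move=> u; apply/asboolP/word_eqv_refl. Qed.

Lemma word_eqvb_sym : symmetric word_eqvb.
Proof. by move=> u v; apply/asboolP/asboolP; exact: word_eqv_sym. Qed.

Lemma word_eqvb_trans : transitive word_eqvb.
Proof.
by move=> v u w /asboolP uv /asboolP vw; apply/asboolP; exact: word_eqv_trans vw.
Qed.

Canonical word_eqv_equiv :=
  EquivRel word_eqvb word_eqvb_refl word_eqvb_sym word_eqvb_trans.

(* The group < X | u = v for all u, v such that rels u v >. *)
Definition presented := {eq_quot word_eqv_equiv}.

HB.instance Definition _ := Choice.on presented.
HB.instance Definition _ := EqQuotient.on presented.

Definition pclass (u : word X) : presented := \pi_presented u.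
Definition prepr (a : presented) : word X := generic_quotient.repr a.

Lemma pclassP u v : pclass u = pclass v <-> word_eqv rels u v.
Proof.
split=> [/eqP|uv]; first by rewrite eqmodE => /asboolP.
by apply/eqP; rewrite eqmodE; apply/asboolP.
Qed.

Lemma pclassK (a : presented) : pclass (prepr a) = a.
Proof. exact: reprK. Qed.

Lemma prepr_pclass u : word_eqv rels (prepr (pclass u)) u.
Proof. by apply/pclassP; rewrite pclassK. Qed.

Definition pmul (a b : presented) := pclass (prepr a ++ prepr b).
Definition pinv (a : presented) := pclass (inv_word (prepr a)).

Lemma pmulE u v : pmul (pclass u) (pclass v) = pclass (u ++ v).
Proof. by apply/pclassP/word_eqv_cat; exact: prepr_pclass. Qed.

Lemma pinvE u : pinv (pclass u) = pclass (inv_word u).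
Proof. by apply/pclassP/word_eqv_inv; exact: prepr_pclass. Qed.

Lemma pmulA : associative pmul.
Proof.
by move=> a b c; rewrite -[a]pclassK -[b]pclassK -[c]pclassK !pmulE catA.
Qed.

Lemma pmul1 : left_id (pclass [::]) pmul.
Proof. by move=> a; rewrite -[a]pclassK pmulE. Qed.

Lemma pmulr1 : right_id (pclass [::]) pmul.
Proof. by move=> a; rewrite -[a]pclassK pmulE cats0. Qed.

Lemma pmulV : left_inverse (pclass [::]) pinv pmul.
Proof.
by move=> a; rewrite -[a]pclassK pinvE pmulE; apply/pclassP/word_eqvV.
Qed.

Lemma pmulrV : right_inverse (pclass [::]) pinv pmul.
Proof.
by move=> a; rewrite -[a]pclassK pinvE pmulE; apply/pclassP/word_eqvVr.
Qed.

HB.instance Definition _ :=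
  isGroup.Build presented pmulA pmul1 pmulr1 pmulV pmulrV.

Lemma pclass0 : pclass [::] = 1. Proof. by []. Qed.

Lemma pclass_cat u v : pclass (u ++ v) = pclass u * pclass v.
Proof. by rewrite [RHS]pmulE. Qed.

Lemma pclass_inv u : pclass (inv_word u) = (pclass u)^-1.
Proof. by rewrite [RHS]pinvE. Qed.

End Presented.

Definition free_group (X : choiceType) := presented (fun _ _ : word X => False).

HB.instance Definition _ (X : choiceType) := Group.on (free_group X).

Definition free_of_infinite_rank (G : groupType) : Prop :=
  exists X : choiceType, infinite_set [set: X] /\
  exists f : {multiplicative free_group X -> G}, bijective f.

(* Strand positions and generators are numbered from 0: the generator j is    *)
(* the crossing of the strands in positions j and j + 1.                      *)
Inductive twin_rels (n : nat) : word 'I_n.-1 -> word 'I_n.-1 -> Prop :=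
| twin_involution (j : 'I_n.-1) : twin_rels [:: (j, true); (j, true)] [::]
| twin_commute (j k : 'I_n.-1) : (j.+1 < k)%N || (k.+1 < j)%N ->
    twin_rels [:: (j, true); (k, true)] [:: (k, true); (j, true)].

Definition twin (n : nat) := presented (@twin_rels n).

HB.instance Definition _ (n : nat) := Group.on (twin n).

Definition twin_gen (n : nat) (j : 'I_n.-1) : twin n := pclass _ [:: (j, true)].

Lemma left_pos_subproof n (j : 'I_n.-1) : (j < n)%N.
Proof. exact: leq_trans (ltn_ord j) (leq_pred n). Qed.

Lemma right_pos_subproof n (j : 'I_n.-1) : (j.+1 < n)%N.
Proof. by rewrite -ltn_predRL. Qed.

Definition left_pos n (j : 'I_n.-1) : 'I_n := Ordinal (left_pos_subproof j).
Definition right_pos n (j : 'I_n.-1) : 'I_n := Ordinal (right_pos_subproof j).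

(* In {perm _}, (s * t) k = t (s k), in accordance with reading a word, hence *)
(* a configuration of strands, from top to bottom.                            *)
Definition word_perm n (w : word 'I_n.-1) : {perm 'I_n} :=
  \prod_(l <- w) tperm (left_pos l.1) (right_pos l.1).

Definition nu n (u : twin n) : {perm 'I_n} := word_perm (prepr u).

(* A generator and its inverse are the same twin, so the sign of a letter is  *)
(* irrelevant. In the cases that occur, insub k is always defined.            *)
Definition delete_letter n (i : 'I_n) (l : 'I_n.-1 * bool) : word 'I_n.-1.-1 :=
  let shifted k := seq_of_opt (omap (fun k' => (k', l.2)) (insub k)) in
  if (i < l.1)%N then shifted l.1.-1
  else if (l.1.+1 < i)%N then shifted (nat_of_ord l.1) else [::].

Fixpoint delete_word n (i : 'I_n) (w : word 'I_n.-1) : word 'I_n.-1.-1 :=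
  if w is l :: w' then
    delete_letter i l
      ++ delete_word (tperm (left_pos l.1) (right_pos l.1) i) w'
  else [::].

(* d i deletes the strand starting at position i (numbered from 0). That d is *)
(* compatible with the relations is dE, and dM, d_gen_before, d_gen_at and    *)
(* d_gen_after are the equations which determine it.                          *)
Definition d n (i : 'I_n) (u : twin n) : twin n.-1 :=
  pclass _ (delete_word i (prepr u)).

Lemma nuE n (w : word 'I_n.-1) : nu (pclass _ w) = word_perm w.
Proof.
suff wp u v : word_eqv (@twin_rels n) u v -> word_perm u = word_perm v.
  exact/wp/prepr_pclass.
rewrite /word_perm; elim=> {u v} //.
- by move=> u v w' _ -> _ ->.
- move=> p x b q; rewrite !big_cat /= !big_cons big_nil mulg1.
  by rewrite tperm2 mul1g.
- move=> p u v q uv; rewrite !big_cat /=; congr (_ * (_ * _)).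
  case: uv => [j|j k jk]; rewrite !big_cons !big_nil !mulg1 /= ?tperm2 //.
  apply/permP => i; rewrite !permM.
  apply/val_inj => /=; rewrite !permE /= -!(inj_eq val_inj) /=.
  rewrite !(fun_if (@nat_of_ord n)) /=.
  by repeat case: eqP => //=; lia.
Qed.

Lemma nu1 n : nu (1 : twin n) = 1.
Proof. by rewrite -pclass0 nuE /word_perm big_nil. Qed.

Lemma nuM n (u v : twin n) : nu (u * v) = nu u * nu v.
Proof.
by rewrite -[u]pclassK -[v]pclassK -pclass_cat !nuE /word_perm big_cat.
Qed.

Lemma nu_gen n (j : 'I_n.-1) :
  nu (twin_gen j) = tperm (left_pos j) (right_pos j).
Proof. by rewrite nuE /word_perm big_cons big_nil mulg1. Qed.

Lemma delete_word_cat n (i : 'I_n) (u v : word 'I_n.-1) :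
  delete_word i (u ++ v) = delete_word i u ++ delete_word (word_perm u i) v.
Proof.
elim: u i => [|l u IH] i /=; first by rewrite /word_perm big_nil perm1.
by rewrite IH /word_perm big_cons permM catA.
Qed.

Lemma tperm_posE n (j : 'I_n.-1) (i : 'I_n) :
  nat_of_ord (tperm (left_pos j) (right_pos j) i) =
    if nat_of_ord i == j then j.+1
    else if nat_of_ord i == j.+1 then nat_of_ord j else i.
Proof.
rewrite permE /= -!(inj_eq val_inj) /=.
by case: eqP => // _; case: eqP.
Qed.

Section DeleteWord.
Variable n : nat.
Local Notation "u ~ v" := (word_eqv (@twin_rels n.-1) u v) (at level 70).
Local Notation letter b k :=
  (seq_of_opt (omap (fun k' : 'I_n.-1.-1 => (k', b)) (insub k))).

Lemma letter_sqr (k : nat) b b' : letter b k ++ letter b' k ~ [::].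
Proof.
case: insubP => [{}k _ _|_] /=; last exact: word_eqv_refl.
have [->|nb] := eqVneq b' (~~ b).
  exact: (word_eqv_cancel _ [::] k b [::]).
have {nb} -> : b' = b by case: b b' nb => -[].
have E := word_eqv_rel [::] [::] (twin_involution k).
case: b; first exact: E.
by have := word_eqv_inv E; rewrite /inv_word /rev /=.
Qed.

Lemma letter_comm (a b : nat) : (a.+1 < b)%N ->
  letter true a ++ letter true b ~ letter true b ++ letter true a.
Proof.
move=> ab.
case: insubP => [j _ ja|_] /=; last by rewrite cats0; exact: word_eqv_refl.
case: insubP => [k _ kb|_] /=; last exact: word_eqv_refl.
have jk : (j.+1 < k)%N || (k.+1 < j)%N.
  by rewrite -[nat_of_ord j]/(val j) -[nat_of_ord k]/(val k) ja kb ab.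
exact: (word_eqv_rel [::] [::] (twin_commute jk)).
Qed.

Lemma delete_letter_sqr (i : 'I_n) (j : 'I_n.-1) b b' :
  delete_letter i (j, b)
    ++ delete_letter (tperm (left_pos j) (right_pos j) i) (j, b') ~ [::].
Proof.
rewrite /delete_letter /= tperm_posE.
move: (nat_of_ord i) (nat_of_ord j) => x y.
case: (x =P y) => ?; case: (x =P y.+1) => ?;
  repeat case: ifP => ? //=; try (exfalso; lia);
  solve [exact: letter_sqr | exact: word_eqv_refl].
Qed.

Lemma delete_letter_comm (i : 'I_n) (j k : 'I_n.-1) : (j.+1 < k)%N ->
  delete_letter i (j, true)
    ++ delete_letter (tperm (left_pos j) (right_pos j) i) (k, true)
  ~ delete_letter i (k, true)
    ++ delete_letter (tperm (left_pos k) (right_pos k) i) (j, true).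
Proof.
rewrite /delete_letter /= !tperm_posE.
move: (nat_of_ord i) (nat_of_ord j) (nat_of_ord k) => x y z yz.
case: (x =P y) => ?; case: (x =P y.+1) => ?;
  case: (x =P z) => ?; case: (x =P z.+1) => ?;
  repeat case: ifP => ? //=; try (exfalso; lia);
  by rewrite ?cats0; solve [exact: word_eqv_refl | apply: letter_comm; lia].
Qed.

Lemma delete_word_eqv (i : 'I_n) (u v : word 'I_n.-1) :
  word_eqv (@twin_rels n) u v -> delete_word i u ~ delete_word i v.
Proof.
move=> uv; elim: uv i => {u v} [u|u v _ IH|u v w _ IH1 _ IH2|p x b q|p u v q uv] i.
- exact: word_eqv_refl.
- exact: word_eqv_sym.
- exact: word_eqv_trans (IH1 i) (IH2 i).
- rewrite !delete_word_cat /= [word_perm [:: _; _]]/word_perm !big_cons big_nil.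
  rewrite mulg1 /= tperm2 perm1 cats0.
  apply: word_eqv_cat (word_eqv_refl _ _) _.
  rewrite -[X in _ ~ X]cat0s.
  by apply: word_eqv_cat (word_eqv_refl _ _); exact: delete_letter_sqr.
- rewrite !delete_word_cat.
  apply: word_eqv_cat (word_eqv_refl _ _) (word_eqv_cat _ _).
    move: (word_perm p i) => {}i.
    case: uv => [j|j k jk] /=; rewrite ?cats0; first exact: delete_letter_sqr.
    by case/orP: jk => ?; [|apply: word_eqv_sym]; exact: delete_letter_comm.
  have -> : word_perm u = word_perm v; last exact: word_eqv_refl.
  by rewrite -!nuE; congr nu; apply/pclassP;
     have := word_eqv_rel [::] [::] uv; rewrite /= !cats0.
Qed.

Lemma dE (i : 'I_n) (w : word 'I_n.-1) :
  d i (pclass _ w) = pclass _ (delete_word i w).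
Proof. by apply/pclassP/delete_word_eqv; exact: prepr_pclass. Qed.

Lemma dM (i : 'I_n) (u v : twin n) : d i (u * v) = d i u * d (nu u i) v.
Proof.
rewrite -[u]pclassK -[v]pclassK -pclass_cat nuE !dE.
by rewrite delete_word_cat pclass_cat.
Qed.

Lemma d1 (i : 'I_n) : d i 1 = 1.
Proof. by rewrite -pclass0 dE. Qed.

Lemma d_gen_before (i : 'I_n) (j : 'I_n.-1) (k : 'I_n.-1.-1) :
  (i < j)%N -> k = j.-1 :> nat -> d i (twin_gen j) = twin_gen k.
Proof.
move=> ij kj; rewrite dE /= cats0 /delete_letter /= ij -kj.
by have -> : insub (nat_of_ord k) = Some k := valK k.
Qed.

Lemma d_gen_at (i : 'I_n) (j : 'I_n.-1) :
  (i == left_pos j) || (i == right_pos j) -> d i (twin_gen j) = 1.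
Proof.
rewrite -!(inj_eq val_inj) /= => ij.
by rewrite dE /= cats0 /delete_letter /= !ifF //; lia.
Qed.

Lemma d_gen_after (i : 'I_n) (j : 'I_n.-1) (k : 'I_n.-1.-1) :
  (j.+1 < i)%N -> k = j :> nat -> d i (twin_gen j) = twin_gen k.
Proof.
move=> ji kj; rewrite dE /= cats0 /delete_letter /= ifF; last lia.
by rewrite ji -kj; have -> : insub (nat_of_ord k) = Some k := valK k.
Qed.

End DeleteWord.

Definition pure_twin (n : nat) : {pred twin n} := [pred u | nu u == 1].

Lemma pure_twin_group_closed n : group_closed (@pure_twin n).
Proof.
split; first by rewrite inE nu1.
move=> u v; rewrite !inE => /eqP nuu /eqP nuv.
have E : nu (v * v^-1) = 1 by rewrite mulgV nu1.
by rewrite nuM nuu mul1g; move: E; rewrite nuM nuv mul1g => ->.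
Qed.

Definition Brun_pred (n : nat) : {pred twin n} :=
  [pred u | (u \in @pure_twin n) && [forall i : 'I_n, d i u == 1]].

Lemma Brun_group_closed n : group_closed (@Brun_pred n).
Proof.
split.
  by rewrite !inE nu1 eqxx; apply/forallP => i; rewrite d1.
move=> u v; rewrite !inE => /andP[/eqP nuu /forallP du] /andP[/eqP nuv /forallP dv].
have nuV : nu v^-1 = 1.
  by have := nu1 n; rewrite -(mulgV v) nuM nuv mul1g.
rewrite nuM nuu nuV mulg1 eqxx; apply/forallP => i.
have : d i (v * v^-1) = 1 by rewrite mulgV d1.
by rewrite !dM nuu nuv !perm1 (eqP (du i)) (eqP (dv i)) => ->.
Qed.

Record Brun (n : nat) := MkBrun { Brun_val : twin n; _ : Brun_val \in @Brun_pred n }.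
HB.instance Definition _ n := [isSub for @Brun_val n].
HB.instance Definition _ n := [Choice of Brun n by <:].
HB.instance Definition _ n :=
  SubChoice_isSubGroup.Build (twin n) (@Brun_pred n) (Brun n)
    (@Brun_group_closed n).

(* Main.v *)
Require Import Defs.
From HB Require Import structures.
From mathcomp Require Import all_boot all_fingroup zify.
From mathcomp Require Import boolp classical_sets cardinality.

(** Write [a], [b], [c] for the generators of T_4. Since [a] and [c] commute,
    T_4 is the free product of V = {1, a, c, ac} and <b>. It acts on a tree
    whose vertices are the cosets uV, the edge u joining uV to ubV. A pure twin
    fixes no vertex, because the permutation homomorphism is faithful on V, and
    inverts no edge, because [b] is an odd permutation. So a subgroup K of the
    pure twins acts freely, and K is the fundamental group of the quotient
    graph Gamma, whose edges are the right cosets Ku, the reverse of Ku being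
    Kub. Hence K is free on the edges of Gamma outside a spanning tree, its
    chords.

    This is carried out algebraically. A spanning tree is given by a section
    of the right cosets of K which is compatible with V ([sectionM]) and whose
    values are reached through tree edges only ([section_ind]). An edge u is
    flat, that is, in the tree, when section (ub) = section u * b. Each chord x
    gives the loop x * b / section (x * b) of K, whence a morphism from the
    free group to K. Its inverse [trace] writes down the chords met along the
    path spelled by a twin, signed by direction; it is well defined because the
    defining relations of T_4 hold for it ([word_trace_eqv]). The two maps are inverse to each other by [psi_traceK] and
    [trace_psiK], which gives [free_lift_chord_bij].

    If K is moreover normal, nontrivial and of infinite index, there are
    infinitely many chords ([infinite_chords]): a word spelling a nontrivial
    element of K is a closed path from every vertex of Gamma, and none of these
    paths stays in the tree, so every coset is at bounded distance from a chord.
    With finitely many chords Gamma would be finite.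

    For the Brunnian twins, deleting any strand kills one of (ab)^3 and (bc)^3,
    so that their commutator is Brunnian; and the powers of ab lie in
    distinct cosets, as they stay distinct when the last strand is deleted.
    Both facts need words to be nontrivial in T_4 or T_3, which is seen on an
    action of the infinite dihedral group on the natural numbers ([step]). *)

Set Implicit Arguments.
Unset Strict Implicit.
Unset Printing Implicit Defensive.

Local Open Scope group_scope.

Local Notation "u / v" := (u * v^-1) : group_scope.

(** * Morphisms from presented and free groups *)

Section PresentedMorphism.
Variables (X : choiceType) (rels : word X -> word X -> Prop) (G : groupType).
Variable h : X -> G.

Definition word_eval (w : word X) : G :=
  \prod_(l <- w) (if l.2 then h l.1 else (h l.1)^-1).

Lemma word_eval_cat u v : word_eval (u ++ v) = word_eval u * word_eval v.
Proof. exact: big_cat. Qed.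

Lemma word_eval_eqv :
  (forall u v, rels u v -> word_eval u = word_eval v) ->
  forall u v, word_eqv rels u v -> word_eval u = word_eval v.
Proof.
move=> hrels u v; elim=> {u v} //.
- by move=> u v w _ -> _ ->.
- move=> p x e q; rewrite catA !word_eval_cat; congr (_ * _).
  rewrite -[RHS]mulg1; congr (_ * _); rewrite /word_eval !big_cons big_nil mulg1.
  by case: e; rewrite /= ?mulgV ?mulVg.
- by move=> p u v q uv; rewrite !word_eval_cat (hrels u v).
Qed.

End PresentedMorphism.

Section FreeGroupMorphism.
Variables (X : choiceType) (G : groupType) (h : X -> G).

Definition free_lift (x : free_group X) : G := word_eval h (prepr x).

Lemma free_liftE w : free_lift (pclass _ w) = word_eval h w.
Proof. by apply: (word_eval_eqv _ (prepr_pclass _ w)). Qed.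

Lemma free_liftM : {morph free_lift : x y / x * y}.
Proof.
move=> x y; rewrite -[x]pclassK -[y]pclassK -pclass_cat !free_liftE.
exact: word_eval_cat.
Qed.

HB.instance Definition _ :=
  isMultiplicative.Build (free_group X) G free_lift free_liftM.

Definition free_gen (x : X) : free_group X := pclass _ [:: (x, true)].

Lemma free_lift_gen x : free_lift (free_gen x) = h x.
Proof. by rewrite free_liftE /word_eval big_seq1. Qed.

Lemma free_lift1 : free_lift 1 = 1.
Proof. by rewrite -pclass0 free_liftE /word_eval big_nil. Qed.

Lemma free_liftV x : free_lift x^-1 = (free_lift x)^-1.
Proof. by apply/esym/mulg1_eq; rewrite -free_liftM mulgV free_lift1. Qed.

Lemma free_ind (P : free_group X -> Prop) :
    P 1 -> (forall x u, P u -> P (free_gen x * u)) ->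
    (forall x u, P u -> P ((free_gen x)^-1 * u)) -> forall u, P u.
Proof.
move=> P1 Pg PV u; rewrite -[u]pclassK; elim: (prepr u) => [//|[x e] w IH].
rewrite -[_ :: w]/([:: (x, e)] ++ w) pclass_cat.
case: e; first exact: Pg.
by rewrite -[pclass _ _]/(pclass _ (inv_word [:: (x, true)])) pclass_inv; apply: PV.
Qed.

End FreeGroupMorphism.

(** * The twin group on four strands as a free product *)

Lemma twin_gen_sqr n (j : 'I_n.-1) : twin_gen j * twin_gen j = 1.
Proof.
rewrite -pclass_cat -pclass0; apply/pclassP.
exact: (word_eqv_rel [::] [::] (twin_involution j)).
Qed.

Lemma twin_genV n (j : 'I_n.-1) : (twin_gen j)^-1 = twin_gen j.
Proof. exact/mulg1_eq/twin_gen_sqr. Qed.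

Lemma twin_genK n (u : twin n) (j : 'I_n.-1) : u * twin_gen j * twin_gen j = u.
Proof. by rewrite -mulgA twin_gen_sqr mulg1. Qed.

Lemma twin_gen_comm n (j k : 'I_n.-1) :
  (j.+1 < k)%N -> commute (twin_gen j) (twin_gen k).
Proof.
move=> jk; rewrite /commute -!pclass_cat; apply/pclassP.
by apply: (word_eqv_rel [::] [::] (twin_commute _)); rewrite jk.
Qed.

Lemma pclass_letter n (l : 'I_n.-1 * bool) :
  pclass (@twin_rels n) [:: l] = twin_gen l.1.
Proof.
case: l => j [] //=; rewrite -[LHS]/(pclass _ (inv_word [:: (j, true)])).
by rewrite pclass_inv twin_genV.
Qed.

Lemma pclass_cons n (l : 'I_n.-1 * bool) w :
  pclass (@twin_rels n) (l :: w) = twin_gen l.1 * pclass _ w.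
Proof. by rewrite -pclass_letter -pclass_cat. Qed.

Lemma twin_ind n (P : twin n -> Prop) :
  P 1 -> (forall u j, P u -> P (u * twin_gen j)) -> forall u, P u.
Proof.
move=> P1 PS u; rewrite -[u]pclassK; elim/last_ind: (prepr u) => [//|w l IH].
by rewrite -cats1 pclass_cat pclass_letter; apply: PS.
Qed.

Local Notation ta := (@twin_gen 4 (@Ordinal 4.-1 0 isT)).
Local Notation tb := (@twin_gen 4 (@Ordinal 4.-1 1 isT)).
Local Notation tc := (@twin_gen 4 (@Ordinal 4.-1 2 isT)).

Lemma gen4P (j : 'I_4.-1) :
  [\/ twin_gen j = ta, twin_gen j = tb | twin_gen j = tc].
Proof.
case: j => [[|[|[|//]]] jlt]; [constructor 1|constructor 2|constructor 3];
  by congr twin_gen; apply/val_inj.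
Qed.

(** The stabilizer of a vertex of the tree on which T_4 acts. *)
Definition vertex_group : {pred twin 4} := [pred v | v \in [:: 1; ta; tc; ta * tc]].

Lemma commute_ac : ta * tc = tc * ta.
Proof. exact: twin_gen_comm. Qed.

Lemma vertex_groupM v w : v \in vertex_group -> w \in vertex_group ->
  v * w \in vertex_group.
Proof.
have Va u : u \in vertex_group -> u * ta \in vertex_group.
  rewrite !inE => /or4P[] /eqP->; rewrite ?mul1g ?twin_gen_sqr ?eqxx ?orbT //.
    by rewrite commute_ac eqxx !orbT.
  by rewrite commute_ac -mulgA twin_gen_sqr mulg1 eqxx !orbT.
have Vc u : u \in vertex_group -> u * tc \in vertex_group.
  rewrite !inE => /or4P[] /eqP->; rewrite ?mul1g ?twin_gen_sqr ?eqxx ?orbT //.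
  by rewrite -mulgA twin_gen_sqr mulg1 eqxx !orbT.
move=> Vv Vw; have : [|| w == 1, w == ta, w == tc | w == ta * tc].
  by move: Vw; rewrite !inE.
case/or4P=> /eqP->; rewrite ?mulg1 //; [exact: Va|exact: Vc|].
by rewrite mulgA; apply/Vc/Va.
Qed.

Lemma vertex_groupV v : v \in vertex_group -> v^-1 = v.
Proof.
rewrite !inE => /or4P[] /eqP->; rewrite ?invg1 ?twin_genV //.
by rewrite invgM !twin_genV commute_ac.
Qed.

(** This is why pure twins fix no vertex of the tree. *)
Lemma vertex_nu1 v : v \in vertex_group -> nu v = 1 -> v = 1.
Proof.
rewrite !inE => /or4P[] /eqP-> //; rewrite ?nuM !nu_gen => nu1;
  exfalso.
- move/permP/(_ (@Ordinal 4 0 isT))/(congr1 val): nu1.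
  by rewrite perm1 /= tperm_posE.
- move/permP/(_ (@Ordinal 4 2 isT))/(congr1 val): nu1.
  by rewrite perm1 /= tperm_posE.
- move/permP/(_ (@Ordinal 4 0 isT))/(congr1 val): nu1.
  by rewrite perm1 permM /= !tperm_posE /=.
Qed.

(** * A spanning tree of the quotient graph *)

Section FreeSubgroup.
Variable K : {pred twin 4}.
Hypothesis K_group : group_closed K.
Hypothesis K_pure : {subset K <= @pure_twin 4}.

Lemma subgroup1 : 1 \in K.
Proof. by case: K_group. Qed.

Lemma subgroupV u : u \in K -> u^-1 \in K.
Proof. exact: (group_closedV K_group). Qed.

Lemma subgroupM u v : u \in K -> v \in K -> u * v \in K.
Proof. exact: (group_closedM K_group). Qed.

Definition coset_eq (u v : twin 4) := u / v \in K.
Local Notation "u ~ v" := (coset_eq u v) (at level 70).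

Lemma coset_refl u : u ~ u.
Proof. by rewrite /coset_eq mulgV subgroup1. Qed.

Lemma coset_sym u v : u ~ v -> v ~ u.
Proof. by move=> /subgroupV; rewrite invgF. Qed.

Lemma coset_trans v u w : u ~ v -> v ~ w -> u ~ w.
Proof.
by move=> uv vw; have := subgroupM uv vw; rewrite /coset_eq mulgA mulgVK.
Qed.

Lemma coset_mulr w u v : u ~ v -> u * w ~ v * w.
Proof. by rewrite /coset_eq mulgKA. Qed.

Lemma coset_mull u v : u \in K -> u * v ~ v.
Proof. by rewrite /coset_eq mulgK. Qed.

Lemma coset_nu u v : u ~ v -> nu u = nu v.
Proof.
move=> /K_pure; rewrite inE => /eqP nuuv.
by rewrite -[u](mulgVK v) nuM nuuv mul1g.
Qed.

(** The action of V on the right cosets of K is free. *)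
Lemma coset_vertex_inj u v w :
  v \in vertex_group -> w \in vertex_group -> u * v ~ u * w -> v = w.
Proof.
move=> Vv Vw /coset_nu; rewrite !nuM => /mulgI nuvw.
rewrite -(vertex_groupV Vw); apply/esym/mulg1_eq/vertex_nu1; first exact: vertex_groupM.
by rewrite nuM nuvw -nuM -{1}(vertex_groupV Vw) mulVg nu1.
Qed.

(** The vertices of the quotient graph are the double cosets KuV. *)
Definition same_vertex u u' := exists2 v, v \in vertex_group & u * v ~ u'.

Lemma same_vertex_coset u u' : u ~ u' -> same_vertex u u'.
Proof. by exists 1; rewrite ?mulg1 // !inE eqxx. Qed.

Lemma same_vertex_mulr u v : v \in vertex_group -> same_vertex u (u * v).
Proof. by exists v; rewrite ?coset_refl. Qed.

Lemma same_vertex_sym u u' : same_vertex u u' -> same_vertex u' u.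
Proof.
case=> v Vv uv; exists v => //; apply: coset_sym.
rewrite -{1}[u](mulgK v) (vertex_groupV Vv); exact: coset_mulr.
Qed.

Lemma same_vertex_trans u' u u'' :
  same_vertex u u' -> same_vertex u' u'' -> same_vertex u u''.
Proof.
case=> v Vv uv [w Vw vw]; exists (v * w); first exact: vertex_groupM.
by rewrite mulgA; apply: coset_trans vw; exact: coset_mulr.
Qed.

(** Existence of a path with n edges from the base vertex KV to KuV. *)
Fixpoint reach n u : Prop :=
  if n is n'.+1 then exists2 u', reach n' u' & same_vertex (u' * tb) u
  else same_vertex 1 u.

Lemma reach_same_vertex n u u' : same_vertex u u' -> reach n u -> reach n u'.
Proof.
case: n => [|n] uu' /=; first by move=> /same_vertex_trans; apply.
by case=> u'' r s; exists u''; last exact: same_vertex_trans uu'.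
Qed.

Lemma reach_ex u : exists n, `[< reach n u >].
Proof.
elim/twin_ind: u => [|u j [n /asboolP r]].
  by exists 0; apply/asboolP/same_vertex_coset/coset_refl.
case: (gen4P j) => ->; last 1 first.
- exists n; apply/asboolP; apply: reach_same_vertex r.
  by apply: same_vertex_mulr; rewrite !inE eqxx ?orbT.
- exists n; apply/asboolP; apply: reach_same_vertex r.
  by apply: same_vertex_mulr; rewrite !inE eqxx ?orbT.
- exists n.+1; apply/asboolP; exists u => //.
  exact/same_vertex_coset/coset_refl.
Qed.

Definition depth u := ex_minn (reach_ex u).

Lemma reach_depth u : reach (depth u) u.
Proof. by rewrite /depth; case: ex_minnP => n /asboolP. Qed.

Lemma depth_min n u : reach n u -> (depth u <= n)%N.
Proof. by rewrite /depth; case: ex_minnP => m _ min /asboolP; exact: min. Qed.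

Lemma depth_same_vertex u u' : same_vertex u u' -> depth u = depth u'.
Proof.
move=> uu'; apply/eqP; rewrite eqn_leq; apply/andP; split; apply: depth_min.
  exact/(reach_same_vertex (same_vertex_sym uu'))/reach_depth.
exact/(reach_same_vertex uu')/reach_depth.
Qed.

Definition parents u : set (twin 4) :=
  [set u' | depth u = (depth u').+1 /\ same_vertex (u' * tb) u].

(** The set of possible parents depends only on the vertex KuV, so choosing from
    it gives one tree edge per vertex other than the base. *)
Definition parent u := xget 1 (parents u).

Lemma parentP u : (0 < depth u)%N -> parents u (parent u).
Proof.
move=> du; apply: xgetPex; move: (reach_depth u).
case E: (depth u) du => [//|n] _ [u' r s]; exists u'; split=> //.
rewrite E; congr _.+1; apply/eqP; rewrite eqn_leq (depth_min r) andbT -ltnS -E.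
by apply: depth_min; exists u'; first exact: reach_depth.
Qed.

Lemma parent_same_vertex u u' : same_vertex u u' -> parent u = parent u'.
Proof.
move=> uu'; rewrite /parent; congr xget; apply/predeqP => v.
rewrite /parents /= (depth_same_vertex uu'); split=> -[? s]; split=> //.
  exact: same_vertex_trans uu'.
by apply: same_vertex_trans s _; exact: same_vertex_sym.
Qed.

(** At the vertex KgV, the only element of gV which lies in the coset Ku. *)
Definition adjust g u :=
  g * xget 1 [set v | v \in vertex_group /\ g * v ~ u].

Lemma adjust_coset g u : same_vertex g u -> adjust g u ~ u.
Proof.
by case=> v Vv gv; rewrite /adjust; case: xgetP => [w _ [] //|/(_ v)[]].
Qed.

Lemma adjustE g u v : v \in vertex_group -> g * v ~ u -> adjust g u = g * v.
Proof.
move=> Vv gv; rewrite /adjust; congr (_ * _); apply: xget_unique => // w [Vw gw].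
by apply: (@coset_vertex_inj g) => //; apply: coset_trans gw (coset_sym gv).
Qed.

(** The twin spelled by the tree path of length n ending at KuV; the vertex
    group elements between consecutive edges are forced by the chosen parents. *)
Fixpoint vertex_rep n u : twin 4 :=
  if n is n'.+1 then adjust (vertex_rep n' (parent u)) (parent u) * tb else 1.

Definition section u := adjust (vertex_rep (depth u) u) u.

Lemma vertex_rep_same_vertex n u u' :
  same_vertex u u' -> vertex_rep n u = vertex_rep n u'.
Proof. by case: n => //= n /parent_same_vertex ->. Qed.

Lemma vertex_repP u : same_vertex (vertex_rep (depth u) u) u.
Proof.
move: {2}(depth u) (erefl (depth u)) => n; elim: n u => [|n IH] u du; rewrite du /=.
  by have := reach_depth u; rewrite du.
have [] := @parentP u; first by rewrite du.
rewrite du => -[dp]; apply: same_vertex_trans.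
apply/same_vertex_coset/coset_mulr/adjust_coset.
by have := IH (parent u); rewrite -dp; apply.
Qed.

Lemma section_coset u : section u ~ u.
Proof. exact/adjust_coset/vertex_repP. Qed.

(** Since V acts freely on cosets, the section is determined on a whole vertex by
    the representative of that vertex. *)
Lemma sectionE u w v : same_vertex u w -> v \in vertex_group ->
  vertex_rep (depth u) u * v ~ w -> section w = vertex_rep (depth u) u * v.
Proof.
move=> uw Vv rv; rewrite /section -(depth_same_vertex uw).
by rewrite -(vertex_rep_same_vertex _ uw); exact: adjustE.
Qed.

Lemma section_vertexP u : exists2 v, v \in vertex_group &
  section u = vertex_rep (depth u) u * v /\ vertex_rep (depth u) u * v ~ u.
Proof.
have [v Vv rv] := vertex_repP u; exists v => //; split=> //.
by apply: sectionE => //; exact/same_vertex_coset/coset_refl.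
Qed.

Lemma section_eq u u' : u ~ u' -> section u = section u'.
Proof.
move=> uu'; have [v Vv [-> rv]] := section_vertexP u.
apply/esym/sectionE => //; first exact: same_vertex_coset.
exact: coset_trans uu'.
Qed.

Lemma sectionM (u v : twin 4) : v \in vertex_group -> section (u * v) = section u * v.
Proof.
move=> Vv; have [w Vw [-> rw]] := section_vertexP u.
rewrite -mulgA; apply: sectionE; [exact: same_vertex_mulr|exact: vertex_groupM|].
by rewrite mulgA; exact: coset_mulr.
Qed.

Lemma section_K u : u \in K -> section u = 1.
Proof.
move=> uK; have s1 : same_vertex 1 u.
  by apply/same_vertex_coset; rewrite /coset_eq div1g subgroupV.
have d0 : depth u = 0%N by apply/eqP; rewrite -leqn0; exact: depth_min.
rewrite (@sectionE u u 1) ?d0 ?mulg1 //; last by rewrite /coset_eq div1g subgroupV.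
  exact/same_vertex_coset/coset_refl.
by rewrite !inE eqxx.
Qed.

(** The edge from Ku to Kub belongs to the spanning tree. *)
Definition flat (u : twin 4) := section (u * tb) = section u * tb.

Lemma section_parent u : (0 < depth u)%N ->
  let p := parent u in
  flat p /\ exists2 v, v \in vertex_group & section u = section (p * tb) * v.
Proof.
move=> du; have [dp sp] := parentP du.
have E : section (parent u * tb) = section (parent u) * tb.
  have su := same_vertex_sym sp.
  have rE : vertex_rep (depth u) u = section (parent u) * tb by rewrite dp.
  rewrite -rE -[RHS]mulg1; apply: sectionE => //; first by rewrite !inE eqxx.
  by rewrite mulg1 rE; apply/coset_mulr/section_coset.
split=> //=; case: sp => v Vv pv; exists v => //.
by rewrite -sectionM //; apply/esym/section_eq.
Qed.

(** The Schreier property: the section is obtained from 1 by moves inside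
    vertices and along tree edges. *)
Lemma section_ind (P : twin 4 -> Prop) :
  P 1 -> (forall u v, v \in vertex_group -> P (section u) -> P (section u * v)) ->
  (forall u, flat u -> P (section u) -> P (section u * tb)) ->
  forall u, P (section u).
Proof.
move=> P1 PV Pb u; move: {2}(depth u) (erefl (depth u)) => n; elim: n u => [|n IH] u du.
  have [v Vv [-> _]] := section_vertexP u; rewrite du /=.
  by rewrite -(section_K subgroup1); apply: PV => //; rewrite section_K ?subgroup1.
have [|fp [v Vv ->]] := @section_parent u; first by rewrite du.
apply: PV => //; rewrite fp; apply: Pb => //; apply: IH.
have [dp _] : parents u (parent u) by apply: parentP; rewrite du.
by move: dp; rewrite du => -[].
Qed.

(** * The free basis *)

(** Edges outside the tree, one for each pair of opposite ones: since [b] is an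
    odd permutation, exactly one of Ku and Kub consists of even twins. *)
Definition is_chord g :=
  [&& section g == g, ~~ odd_perm (nu g) & section (g * tb) != g * tb].

Definition chord := {g : twin 4 | is_chord g}.

Definition chord_loop (x : chord) : twin 4 :=
  val x * tb / section (val x * tb).

Lemma chord_loop_in x : chord_loop x \in K.
Proof. exact/coset_sym/section_coset. Qed.

(** The generator attached to the edge Kg, and 1 for a tree edge. *)
Definition chord_gen g : free_group chord :=
  oapp (@free_gen chord) 1 (insub g).

(** The element of the free group read off when crossing the edge from Ku to
    Kub: on odd cosets it is the inverse of the generator of the reverse
    edge. *)
Definition label u :=
  if odd_perm (nu u) then (chord_gen (section (u * tb)))^-1
  else chord_gen (section u).

Lemma odd_mulb (u : twin 4) : odd_perm (nu (u * tb)) = ~~ odd_perm (nu u).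
Proof.
by rewrite nuM odd_permM nu_gen odd_tperm -(inj_eq val_inj) /= addbT.
Qed.

Lemma labelV (u : twin 4) : label (u * tb) = (label u)^-1.
Proof.
rewrite /label odd_mulb twin_genK.
by case: (odd_perm _); rewrite ?invgK.
Qed.

Lemma label_eq u v : u ~ v -> label u = label v.
Proof.
move=> uv; rewrite /label (coset_nu uv) (section_eq uv).
by rewrite (section_eq (coset_mulr tb uv)).
Qed.

Lemma section_odd u : odd_perm (nu (section u)) = odd_perm (nu u).
Proof. by rewrite (coset_nu (section_coset u)). Qed.

Lemma section_section u : section (section u) = section u.
Proof. exact/section_eq/section_coset. Qed.

Lemma section_sectionb (u : twin 4) : section (section u * tb) = section (u * tb).
Proof. exact/section_eq/coset_mulr/section_coset. Qed.

Lemma is_chord_section (u : twin 4) :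
  is_chord (section u) = ~~ odd_perm (nu u) && (section (u * tb) != section u * tb).
Proof. by rewrite /is_chord section_section eqxx section_odd section_sectionb. Qed.

Local Notation psi := (free_lift chord_loop).

Lemma psi_label (u : twin 4) : psi (label u) = section u * tb / section (u * tb).
Proof.
have even v : ~~ odd_perm (nu v) ->
    psi (chord_gen (section v)) = section v * tb / section (v * tb).
  move=> ev; rewrite /chord_gen; case: insubP => [x _ xE|] /=.
    by rewrite free_lift_gen /chord_loop xE section_sectionb.
  rewrite is_chord_section ev /= negbK => /eqP ->.
  by rewrite free_lift1 mulgV.
rewrite /label; case: ifP => [ou|/negbT/even //].
rewrite free_liftV even ?odd_mulb ?ou // twin_genK.
by rewrite invgF invgM twin_genV mulgA.
Qed.

Lemma label_flat u : flat u -> label u = 1.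
Proof.
move=> fu; have fub : section (u * tb * tb) = section (u * tb) * tb.
  by rewrite fu !twin_genK.
rewrite /label /chord_gen; case: ifP => ou; rewrite insubF ?invg1 //.
  by rewrite is_chord_section fub eqxx andbF.
by rewrite is_chord_section fu eqxx andbF.
Qed.

Lemma label_chord (x : chord) : label (val x) = free_gen x.
Proof.
have /and3P[/eqP sx ex _] := valP x.
by rewrite /label (negbTE ex) sx /chord_gen valK.
Qed.

Lemma chord_near u : ~ flat u -> exists x : chord, val x ~ u \/ val x * tb ~ u.
Proof.
move=> nf; case ou: (odd_perm (nu u)).
  have ex : is_chord (section (u * tb)).
    rewrite is_chord_section odd_mulb ou twin_genK /=.
    apply/eqP => su; apply: nf.
    by rewrite /flat su twin_genK.
  exists (Sub _ ex); right; rewrite SubK.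
  have := coset_mulr tb (section_coset (u * tb)).
  by rewrite !twin_genK.
have ex : is_chord (section u) by rewrite is_chord_section ou /=; apply/eqP.
by exists (Sub _ ex); left; rewrite SubK; exact: section_coset.
Qed.

(** The letters [a] and [c] stay at a vertex of the quotient graph, so only [b],
    the generator number 1, contributes. *)
Fixpoint word_trace u (w : word 'I_4.-1) : free_group chord :=
  if w is l :: w' then
    (if val l.1 == 1%N then label u else 1) * word_trace (u * twin_gen l.1) w'
  else 1.

Lemma word_trace_cat u w w' :
  word_trace u (w ++ w') = word_trace u w * word_trace (u * pclass _ w) w'.
Proof.
elim: w u => [|l w IH] u; first by rewrite mul1g pclass0 mulg1.
rewrite cat_cons pclass_cons [LHS]/= IH [word_trace u (l :: w)]/=.
by rewrite !mulgA.
Qed.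

(** A path through an edge and back cancels, and the remaining relations only
    involve letters that contribute nothing. *)
Lemma word_trace_eqv u w w' :
  word_eqv (@twin_rels 4) w w' -> word_trace u w = word_trace u w'.
Proof.
have sqr v (j : 'I_4.-1) e e' : word_trace v [:: (j, e); (j, e')] = 1.
  rewrite /= mulg1; case: eqP => [jb|_]; last by rewrite mulg1.
  have -> : j = @Ordinal 4.-1 1 isT by exact: val_inj.
  by rewrite labelV mulgV.
move=> ww'; elim: ww' u => {w w'} // [w w' w'' _ IH1 _ IH2|p j e q|p w w' q ww'] u.
- by rewrite IH1.
- have E : pclass (@twin_rels 4) [:: (j, e); (j, ~~ e)] = 1.
    by rewrite -pclass0; apply/pclassP/(word_eqv_cancel _ [::] j e [::]).
  by rewrite !word_trace_cat sqr mul1g E mulg1.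
- rewrite !word_trace_cat.
  have <- : pclass (@twin_rels 4) w = pclass _ w'.
    by apply/pclassP; have := word_eqv_rel [::] [::] ww'; rewrite /= !cats0.
  congr (_ * (_ * _)); case: ww' => [j|j k jk]; first exact: sqr.
  have [jb kb] : (j == 1%N :> nat) = false /\ (k == 1%N :> nat) = false.
    by move: jk (ltn_ord j) (ltn_ord k) => /=; lia.
  by rewrite /= jb kb.
Qed.

Definition trace (u w : twin 4) := word_trace u (prepr w).

Lemma traceE u w : trace u (pclass _ w) = word_trace u w.
Proof. exact/word_trace_eqv/prepr_pclass. Qed.

Lemma traceM (u w w' : twin 4) : trace u (w * w') = trace u w * trace (u * w) w'.
Proof.
by rewrite -[w]pclassK -[w']pclassK -pclass_cat !traceE word_trace_cat.
Qed.

Lemma trace1 u : trace u 1 = 1.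
Proof. by rewrite -pclass0 traceE. Qed.

Lemma traceV (u w : twin 4) : trace (u * w) w^-1 = (trace u w)^-1.
Proof. by apply/esym/mulg1_eq; rewrite -traceM mulgV trace1. Qed.

Lemma trace_gen u j :
  trace u (twin_gen j) = if val j == 1%N then label u else 1.
Proof. by rewrite traceE /= mulg1. Qed.

Lemma trace_vertex u v : v \in vertex_group -> trace u v = 1.
Proof.
by rewrite !inE => /or4P[] /eqP->; rewrite ?traceM ?trace_gen ?trace1 ?mulg1.
Qed.

Lemma trace_eq (u v w : twin 4) : u ~ v -> trace u w = trace v w.
Proof.
rewrite /trace; elim: (prepr w) u v => //= l {}w IH u v uv.
by rewrite (label_eq uv) (IH _ _ (coset_mulr _ uv)).
Qed.

Lemma trace_section u : trace 1 (section u) = 1.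
Proof.
move: u; apply: (@section_ind (fun g => trace 1 g = 1)) => [|u v Vv IH|u fu IH].
- exact: trace1.
- by rewrite traceM IH trace_vertex ?mulg1.
- rewrite traceM IH trace_gen /= !mul1g.
  by rewrite (label_eq (section_coset u)) label_flat.
Qed.

(** The product telescopes: every letter t read at u contributes
    section u * t / section (u * t). *)
Lemma psi_trace (u w : twin 4) : psi (trace u w) = section u * w / section (u * w).
Proof.
elim/twin_ind: w => [|w j IH]; first by rewrite trace1 free_lift1 !mulg1 mulgV.
rewrite traceM free_liftM {}IH trace_gen.
have V1 (v : twin 4) : v \in vertex_group ->
    section u * w / section (u * w) = section u * (w * v) / section (u * (w * v)).
  move=> Vv; rewrite (mulgA u w v) (@sectionM (u * w) v Vv).
  by rewrite (mulgA (section u) w v) mulgKA.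
case: j => [[|[|[|//]]] jlt] /=.
- have -> : Ordinal jlt = @Ordinal 4.-1 0 isT by exact: val_inj.
  by rewrite free_lift1 mulg1 (V1 ta) // !inE eqxx orbT.
- have -> : Ordinal jlt = @Ordinal 4.-1 1 isT by exact: val_inj.
  have E (x y z t : twin 4) : x / y * (y * z / t) = x * z / t.
    by rewrite !mulgA mulgVK.
  by rewrite psi_label E (mulgA u w) (mulgA (section u)).
- have -> : Ordinal jlt = @Ordinal 4.-1 2 isT by exact: val_inj.
  by rewrite free_lift1 mulg1 (V1 tc) // !inE eqxx !orbT.
Qed.

Lemma psi_traceK u : u \in K -> psi (trace 1 u) = u.
Proof.
move=> uK; rewrite psi_trace !mul1g section_K ?subgroup1 // section_K //.
by rewrite mul1g invg1 mulg1.
Qed.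

(** On K the trace is a morphism, a path of K ending in the coset where it
    started. *)
Lemma traceMK u w : u \in K -> trace 1 (u * w) = trace 1 u * trace 1 w.
Proof.
move=> uK; rewrite traceM mul1g; congr (_ * _); apply: trace_eq.
by rewrite -[u in u ~ _]mulg1; exact: coset_mull.
Qed.

(** The loop of x goes to x and comes back through the tree, so it meets no other
    chord. *)
Lemma trace_chord_loop x : trace 1 (chord_loop x) = free_gen x.
Proof.
have /and3P[/eqP sx _ _] := valP x.
rewrite /chord_loop !traceM !mul1g trace_gen /= label_chord.
rewrite -{1}sx trace_section mul1g -[RHS]mulg1; congr (_ * _).
have /trace_eq -> : val x * tb ~ 1 * section (val x * tb).
  by rewrite mul1g; exact/coset_sym/section_coset.
by rewrite traceV trace_section invg1.
Qed.

Lemma trace_psiK f : trace 1 (psi f) = f.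
Proof.
elim/free_ind: f => [|x f IH|x f IH]; first by rewrite free_lift1 trace1.
  rewrite free_liftM free_lift_gen traceMK ?chord_loop_in // IH.
  by rewrite trace_chord_loop.
have lK := chord_loop_in x.
rewrite free_liftM free_liftV free_lift_gen traceMK ?subgroupV // IH.
congr (_ * _); apply/esym/mulg1_eq.
by rewrite -trace_chord_loop -traceMK // mulgV trace1.
Qed.

Variable H : subGroupType K.

Definition chord_elt (x : chord) : H := Sub (chord_loop x) (chord_loop_in x).

Lemma val_chord_elt x : val (chord_elt x) = chord_loop x.
Proof. exact: SubK. Qed.

Lemma val_free_lift f : val (free_lift chord_elt f) = psi f.
Proof.
elim/free_ind: f => [|x f IH|x f IH]; first by rewrite !free_lift1 val1.
  by rewrite !free_liftM valM !free_lift_gen IH val_chord_elt.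
have valV (v : H) : val v^-1 = (val v)^-1 by exact: gmulfV.
by rewrite !free_liftM !free_liftV valM valV !free_lift_gen IH val_chord_elt.
Qed.

Lemma free_lift_chord_bij : bijective (free_lift chord_elt).
Proof.
exists (fun u => trace 1 (val u)) => [f|u].
  by rewrite val_free_lift trace_psiK.
by apply: val_inj; rewrite val_free_lift psi_traceK //; exact: valP.
Qed.

(** * Infinitely many chords *)

(** Along a path inside the tree the section follows the word letter by letter. *)
Lemma flat_path (u : twin 4) (w : word 'I_4.-1) :
  (forall n, (n <= size w)%N -> flat (u * pclass _ (take n w))) ->
  section (u * pclass _ w) = section u * pclass _ w.
Proof.
elim: w u => [|l w IH] u fl; first by rewrite pclass0 !mulg1.
have fu : flat u by have := fl 0%N isT; rewrite pclass0 mulg1.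
rewrite pclass_cons !mulgA IH => [|n nw]; last first.
  have : flat (u * pclass _ (l :: take n w)) by exact: (fl n.+1 nw).
  by rewrite pclass_cons mulgA.
congr (_ * _).
by case: (gen4P l.1) => ->; rewrite ?fu // sectionM // !inE eqxx ?orbT.
Qed.

Hypothesis K_normal : forall u k : twin 4, k \in K -> u * k / u \in K.

(** Normality makes a word of k spell a closed path from every coset; such a path
    must leave the tree since k is not 1. So each coset e m is determined by a
    chord on that path, the position where it is met and its direction. *)
Lemma infinite_chords k (e : nat -> twin 4) :
  k \in K -> k != 1 -> (forall m n, e m ~ e n -> m = n) ->
  infinite_set [set: chord].
Proof.
move=> kK k1 e_inj finX.
pose w := prepr k.
have near m : exists p : chord * ('I_(size w).+1 * bool),
    val p.1 * (if p.2.2 then tb else 1) / pclass _ (take p.2.1 w) ~ e m.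
  have [n nw nf] : exists2 n, (n <= size w)%N & ~ flat (e m * pclass _ (take n w)).
    apply: contrapT => nex; move/eqP: k1; apply.
    have fl n : (n <= size w)%N -> flat (e m * pclass _ (take n w)).
      by move=> nw; apply: contrapT => nf; apply: nex; exists n.
    have := flat_path fl; rewrite pclassK.
    rewrite (@section_eq _ (e m)) => [E|]; last exact: K_normal.
    by apply: (@mulgI _ (section (e m))); rewrite mulg1.
  have [x xE] := chord_near nf.
  have nw' : (n < (size w).+1)%N by [].
  case: xE => xE; [exists (x, (Ordinal nw', false))|exists (x, (Ordinal nw', true))];
    have := coset_mulr (pclass _ (take n w))^-1 xE; rewrite mulgK //=.
  by rewrite mulg1.
have [g gE] := choice near.
have g_inj : injective g.
  by move=> m n gmn; apply: e_inj; apply: coset_trans (gE n); rewrite -gmn;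
     exact/coset_sym.
have fin : finite_set [set: chord * ('I_(size w).+1 * bool)].
  have : finite_set ([set: chord] `*` [set: 'I_(size w).+1 * bool])%classic.
    by apply: finite_setX => //; exact: finite_finset.
  by apply: sub_finite_set.
have := @finite_preimage _ _ _ g (in2W g_inj) fin.
by rewrite preimage_setT; exact: infinite_nat.
Qed.

End FreeSubgroup.

(** * Brunnian twins *)

Lemma BrunP n (u : twin n) :
  reflect (nu u = 1 /\ forall i, d i u = 1) (u \in @Brun_pred n).
Proof.
rewrite !inE; apply: (iffP andP) => -[/eqP nu1 du].
  by split=> // i; apply/eqP/(forallP du).
by split=> //; apply/forallP => i; apply/eqP.
Qed.

Lemma Brun_pure n : {subset @Brun_pred n <= @pure_twin n}.
Proof. by move=> u /BrunP[nu1 _]; rewrite inE nu1. Qed.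

(** Deleting a strand of u * k / u deletes a strand of k, which makes k trivial
    and leaves u / u. *)
Lemma Brun_normal n (u k : twin n) :
  k \in @Brun_pred n -> u * k / u \in @Brun_pred n.
Proof.
move=> /BrunP[nuk dk]; apply/BrunP; split=> [|i].
  by rewrite !nuM nuk mulg1 -nuM mulgV nu1.
by rewrite !dM dk mulg1 nuM nuk mulg1 -dM mulgV d1.
Qed.

Lemma nuV n (u : twin n) : nu u^-1 = (nu u)^-1.
Proof. by apply/esym/mulg1_eq; rewrite -nuM mulgV nu1. Qed.

Lemma d_pureV n (u : twin n) i : nu u = 1 -> d i u^-1 = (d i u)^-1.
Proof.
move=> nuu; apply/esym/mulg1_eq.
by have := d1 i; rewrite -(mulgV u) dM nuu perm1.
Qed.

(** * Computing with words *)

Definition positions n (w : word 'I_n.-1) : seq nat := [seq val l.1 | l <- w].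

Section PositionAction.
Variables (T : Type) (f : nat -> T -> T).

Definition act (x : T) (s : seq nat) : T := foldl (fun y j => f j y) x s.

(** What a word does to a point depends only on the twin it spells, so moving a
    point shows that a twin is not 1. *)
Lemma act_eqv n :
  (forall j, involutive (f j)) ->
  (forall j k x, (j.+1 < k < n.-1)%N -> f j (f k x) = f k (f j x)) ->
  forall w w', word_eqv (@twin_rels n) w w' ->
  forall x, act x (positions w) = act x (positions w').
Proof.
move=> f_inv f_comm w w'; rewrite /act /positions; elim=> {w w'} //.
- by move=> u v w _ IH1 _ IH2 x; rewrite IH1.
- by move=> p j e q x; rewrite !map_cat !foldl_cat /= f_inv.
- move=> p u v q uv x; rewrite !map_cat !foldl_cat; congr foldl.
  case: uv => [j|j k jk] /=; first by rewrite f_inv.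
  have [jn kn] := (ltn_ord j, ltn_ord k).
  by case/orP: jk => jk; [apply/esym|]; apply: f_comm; apply/andP.
Qed.

End PositionAction.

(** The two generating reflections of the infinite dihedral group, acting on the
    half-line 0 - 1 - 2 - ...: the first exchanges 2x and 2x + 1, the second
    exchanges 2x + 1 and 2x + 2 and fixes 0. *)
Definition step (b : bool) (x : nat) := if odd x == b then x.+1 else x.-1.

Lemma step_inv b : involutive (step b).
Proof.
by case: b => -[//|x]; rewrite /step /=; case ox: (odd x); rewrite /= ox.
Qed.

(** Strand deletion and the permutation of a word are replayed on positions in
    nat, where they reduce by computation. *)
Definition swap (m i : nat) :=
  if i == m then m.+1 else if i == m.+1 then m else i.

Fixpoint delete_positions (i : nat) (s : seq nat) : seq nat :=
  if s is m :: s' then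
    (if (i < m)%N then [:: m.-1] else if (m.+1 < i)%N then [:: m] else [::])
      ++ delete_positions (swap m i) s'
  else [::].

Lemma val_word_perm n (w : word 'I_n.-1) i :
  val (word_perm w i) = act swap (val i) (positions w).
Proof.
elim: w i => [|l w IH] i /=; first by rewrite /word_perm big_nil perm1.
by rewrite /word_perm big_cons permM -/(word_perm w) IH /= tperm_posE.
Qed.

Lemma positions_delete n (i : 'I_n) (w : word 'I_n.-1) :
  positions (delete_word i w) = delete_positions (val i) (positions w).
Proof.
rewrite /positions; elim: w i => [//|[j e] w IH] i /=.
rewrite map_cat IH /= tperm_posE; congr (_ ++ _).
rewrite /delete_letter /=; have [iw jw] := (ltn_ord i, ltn_ord j).
case: ifP => ij; last case: ifP => ji //.
  by case: insubP => [k _ kE|] /=; [congr [:: _]; exact: kE|lia].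
by case: insubP => [k _ kE|] /=; [congr [:: _]; exact: kE|lia].
Qed.

Lemma twin_square n (w : word 'I_n.-1) m :
  positions w = [:: m; m] -> pclass (@twin_rels n) w = 1.
Proof.
case: w => [//|[j e] [//|[k e'] [|//]]] /= [jm km].
rewrite !pclass_cons pclass0 mulg1 /=.
by rewrite (_ : k = j) ?twin_gen_sqr //; apply: val_inj; rewrite /= km.
Qed.

(** * A nontrivial Brunnian twin *)

Definition word_ab : word 'I_4.-1 :=
  [:: (@Ordinal 4.-1 0 isT, true); (@Ordinal 4.-1 1 isT, true)].

Definition word_bc : word 'I_4.-1 :=
  [:: (@Ordinal 4.-1 1 isT, true); (@Ordinal 4.-1 2 isT, true)].

Definition word_ab3 := word_ab ++ word_ab ++ word_ab.
Definition word_bc3 := word_bc ++ word_bc ++ word_bc.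

Definition twin_ab3 : twin 4 := pclass _ word_ab3.
Definition twin_bc3 : twin 4 := pclass _ word_bc3.

Lemma nu_ab3 : nu twin_ab3 = 1.
Proof.
rewrite nuE; apply/permP => i; apply: val_inj; rewrite val_word_perm perm1.
by case: i => [[|[|[|[|//]]]] ?].
Qed.

Lemma nu_bc3 : nu twin_bc3 = 1.
Proof.
rewrite nuE; apply/permP => i; apply: val_inj; rewrite val_word_perm perm1.
by case: i => [[|[|[|[|//]]]] ?].
Qed.

(** Without one of the first three strands, only the square of a generator is
    left. *)
Lemma d_ab3 (i : 'I_4) : (i < 3)%N -> d i twin_ab3 = 1.
Proof.
move=> i_lt; rewrite dE; apply: (@twin_square _ _ 0); rewrite positions_delete.
by case: i i_lt => [[|[|[|[|//]]]] ?].
Qed.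

Lemma d_bc3 (i : 'I_4) : (0 < i)%N -> d i twin_bc3 = 1.
Proof.
move=> i_gt; rewrite dE; apply: (@twin_square _ _ 1); rewrite positions_delete.
by case: i i_gt => [[|[|[|[|//]]]] ?].
Qed.

Definition commutator_twin : twin 4 :=
  twin_ab3 * twin_bc3 * twin_ab3^-1 * twin_bc3^-1.

Lemma commutator_twin_Brun : commutator_twin \in @Brun_pred 4.
Proof.
apply/BrunP; split=> [|i].
  by rewrite !nuM !nuV nu_ab3 nu_bc3 !invg1 !mulg1.
rewrite !dM !nuM !nuV nu_ab3 nu_bc3 !invg1 !mulg1 !perm1 !d_pureV ?nu_ab3 ?nu_bc3 //.
have [i0|i_gt0] := posnP i; first by rewrite d_ab3 ?i0 // invg1 mul1g mulg1 mulgV.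
by rewrite (d_bc3 i_gt0) invg1 !mulg1 mulgV.
Qed.

Lemma commutator_twin_neq1 : commutator_twin != 1.
Proof.
(* a acts trivially, b and c as the two reflections; the commutator moves 0. *)
pose f j := if j is 0 then id else step (~~ odd j).
have f_inv j : involutive (f j) by case: j => //= j; exact: step_inv.
have f_comm j k x : (j.+1 < k < 4.-1)%N -> f j (f k x) = f k (f j x).
  by case: j => // j; lia.
have -> : commutator_twin =
    pclass _ (word_ab3 ++ word_bc3 ++ inv_word word_ab3 ++ inv_word word_bc3).
  rewrite (pclass_cat _ word_ab3) (pclass_cat _ word_bc3).
  rewrite (pclass_cat _ (inv_word word_ab3)) !(pclass_inv _ word_ab3).
  by rewrite (pclass_inv _ word_bc3) !mulgA.
by apply/eqP => /pclassP /(act_eqv f_inv f_comm)/(_ 0%N); vm_compute.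
Qed.

(** * Infinite index *)

Definition word_abX m : word 'I_4.-1 := flatten (nseq m word_ab).

Lemma delete_abX m :
  positions (delete_word (@Ordinal 4 3 isT) (word_abX m)) =
    flatten (nseq m [:: 0%N; 1%N]).
Proof. by rewrite positions_delete /=; elim: m => //= m ->. Qed.

Lemma act_abX m x :
  act (fun j => step (odd j)) x.*2 (flatten (nseq m [:: 0%N; 1%N])) = (x + m).*2.
Proof.
elim: m x => [|m IH] x; first by rewrite addn0.
have s0 : step false x.*2 = x.*2.+1 by rewrite /step odd_double.
have s1 : step true x.*2.+1 = x.+1.*2 by rewrite /step /= odd_double.
by rewrite /= /act /= s0 s1 -/(act _ _ _) IH addSnnS.
Qed.

(** Deleting the last strand turns (ab)^m into the m-th power of a product of two
    reflections, which moves 0 to 2m on the half-line. *)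
Lemma abX_coset_inj m n :
  pclass _ (word_abX m) / pclass _ (word_abX n) \in @Brun_pred 4 -> m = n.
Proof.
set u := pclass _ (word_abX m); set v := pclass _ (word_abX n).
move=> /BrunP[nu1 duv]; have := dM (@Ordinal 4 3 isT) (u / v) v.
rewrite mulgVK nu1 perm1 duv mul1g !dE => /pclassP uv.
have f_comm j k x : (j.+1 < k < 4.-1.-1)%N ->
  step (odd j) (step (odd k) x) = step (odd k) (step (odd j) x) by lia.
have := act_eqv (fun j => @step_inv (odd j)) f_comm uv 0.*2.
by rewrite !delete_abX !act_abX => /double_inj.
Qed.

Theorem theorem3p5 : free_of_infinite_rank (Brun 4).
Proof.
have K_group := @Brun_group_closed 4; have K_pure := @Brun_pure 4.
exists (chord K_group); split.
  exact: (infinite_chords K_pure (@Brun_normal 4)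
            commutator_twin_Brun commutator_twin_neq1 (@abX_coset_inj)).
exists (free_lift (@chord_elt _ K_group (Brun 4))).
exact: free_lift_chord_bij.
Qed.
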